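(* Suppose that $(G,H,\sigma)$ is a reduced ($n$-dimensional) Hecke triple. Let $\lambda_\sigma=\operatorname{Ind}_H^G\sigma$ be the induced representation of $G$ on $l^2(G,H,\sigma)$, and let $\mathcal{R}(G,H,\sigma)$ be the von Neumann algebra generated by $\widetilde R(\mathcal{H}_\sigma(G,H))$ in $\mathcal{B}(l^2(G,H,\sigma))$. Then the commutant $\lambda_\sigma(G)'$ equals $\mathcal{R}(G,H,\sigma)$.
   Context: A Hecke pair $(G,H)$ is a group $G$ with a subgroup $H$ such that $[H:H\cap xHx^{-1}]<\infty$ for all $x\in G$; it is reduced if $\bigcap_{x\in G}xHx^{-1}=\{e\}$. An $n$-dimensional Hecke triple $(G,H,\sigma)$ is a Hecke pair $(G,H)$ with a unitary representation $\sigma$ of $H$ on an $n$-dimensional Hilbert space $V_\sigma$ such that $\sigma(H)$ is finite; put $K=\ker\sigma$. The triple is reduced if the Hecke pair $(G,K)$ is reduced. $\mathcal{H}_\sigma(G,H)$ is the $*$-algebra of functions $f:G\to\mathcal{B}(V_\sigma)$ with finite support in $H\backslash G/H$ and $f(hxk)=\sigma(h)f(x)\sigma(k)$ for $h,k\in H$, $x\in G$, with convolution $f*g(x)=\sum_{yH\in G/H}f(y)g(y^{-1}x)$ and involution $f^*(x)=\Delta_K(x^{-1})f(x^{-1})^*$, where $\Delta_K(x)=[K:K\cap xKx^{-1}]/[K:K\cap x^{-1}Kx]$. The Hilbert space $l^2(G,H,\sigma)$ is $$\{\xi:G\to V_\sigma\mid \xi(xh)=\sigma(h^{-1})\xi(x)\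 \forall x\in G,h\in H,\ \textstyle\sum_{x\in G/H}\|\xi(x)\|^2<\infty\},$$ and $(\lambda_\sigma(x)\xi)(y)=\xi(x^{-1}y)$. The nondegenerate $*$-representation $\widetilde R$ of $\mathcal{H}_\sigma(G,H)$ on $l^2(G,H,\sigma)$ is given by $$(\widetilde R(f)\xi)(y)=\sum_{z\in G/H}\Delta_K(z)^{1/2}f(z)\xi(yz).$$ Here $z\in G/H$ means that $z$ runs over a set of representatives of the left cosets. *)

(* Defs.v *)
From HB Require Import structures.
From mathcomp Require Import all_boot all_order all_algebra.
From mathcomp Require Import all_classical all_reals all_analysis.
From mathcomp Require Import finmap complex ring lra.
Set Implicit Arguments.
Unset Strict Implicit.
Unset Printing Implicit Defensive.
Import Order.TTheory GRing.Theory Num.Theory.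
Local Open Scope classical_set_scope.
Local Open Scope ring_scope.
Local Open Scope complex_scope.

Section HeckePairs.
Variable G : groupType.
Implicit Types (A B C H K : set G) (x : G).

Definition lcoset x B : set G := [set (x * b)%g | b in B].

Definition lcosets A B : set (set G) := [set lcoset a B | a in A].

Definition dcoset H x : set G := [set (h * x * k)%g | h in H & k in H].

Definition conjugate x H : set G := [set (x * h * x^-1)%g | h in H].

(* [index A B] is [A : B], with the convention that it is 0 if infinite. *)
Definition index A B : nat := #|` fset_set (lcosets A B)|%fset.

(* All sums over G/H below are sums over the set of cosets [lcosets setT H],
   evaluated at these representatives. *)
Definition repr (C : set G) : G := xget 1%g C.

Definition hecke_pair H : Prop :=
  group_closed (mem H) /\
  forall x, finite_set (lcosets H (H `&` conjugate x H)).

Definition reduced_hecke_pair H : Prop :=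
  hecke_pair H /\ \bigcap_x conjugate x H = [set 1%g].

Definition modular (R : realType) K x : R :=
  (index K (K `&` conjugate x K))%:R / (index K (K `&` conjugate x^-1%g K))%:R.

Section Cosets.
Variable H : set G.
Hypothesis Hgrp : group_closed (mem H).

Lemma grp1 : H 1%g. Proof. by have [H1 _] := Hgrp; exact: (@set_mem _ H). Qed.

Lemma grpV x : H x -> H x^-1%g.
Proof. by move=> /mem_set Hx; exact: (@set_mem _ H _ (group_closedV Hgrp Hx)). Qed.

Lemma grpM x y : H x -> H y -> H (x * y)%g.
Proof. by move=> /mem_set Hx /mem_set Hy; exact: (@set_mem _ H _ (group_closedM Hgrp Hx Hy)). Qed.

Lemma mem_lcoset x : lcoset x H x.
Proof. by exists 1%g; [exact: grp1|rewrite mulg1]. Qed.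

Lemma lcosetMr x h : H h -> lcoset (x * h)%g H = lcoset x H.
Proof.
move=> Hh; apply/seteqP; split=> _ [k Hk <-].
  by exists (h * k)%g; [exact: grpM|rewrite mulgA].
exists (h^-1 * k)%g; first by apply: grpM => //; exact: grpV.
by rewrite -mulgA mulVKg.
Qed.

Lemma lcosets_lcoset x : lcosets setT H (lcoset x H).
Proof. by exists x. Qed.

Lemma lcoset_repr C : lcosets setT H C -> lcoset (repr C) H = C.
Proof.
move=> [x _ <-]; have [h Hh <-] : lcoset x H (repr (lcoset x H)).
  by apply: xgetPex; exists x; exact: mem_lcoset.
exact: lcosetMr.
Qed.

Lemma repr_lcoset x : exists2 h, H h & repr (lcoset x H) = (x * h)%g.
Proof.
have [h Hh e] : lcoset x H (repr (lcoset x H)).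
  by apply: xgetPex; exists x; exact: mem_lcoset.
by exists h.
Qed.

Lemma lcoset_eq x y : lcoset x H = lcoset y H -> exists2 h, H h & y = (x * h)%g.
Proof. by move=> e; have [h Hh <-] : lcoset x H y; [rewrite e; exact: mem_lcoset|exists h]. Qed.

Lemma lcoset_translate_bij g : set_bij (lcosets setT H) (lcosets setT H)
  (fun C => lcoset (g * repr C)%g H).
Proof.
split.
- by move=> C _; exact: lcosets_lcoset.
- move=> C D /set_mem/lcoset_repr + /set_mem/lcoset_repr => {2}<- {2}<- /lcoset_eq[h Hh].
  by rewrite -mulgA => /mulgI ->; rewrite lcosetMr.
- move=> _ [x _ <-]; exists (lcoset (g^-1 * x)%g H); first exact: lcosets_lcoset.
  have [h Hh ->] := repr_lcoset (g^-1 * x).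
  by rewrite mulgA mulVKg lcosetMr.
Qed.

End Cosets.

Lemma conjugateM x y A : conjugate (x * y)%g A = conjugate x (conjugate y A).
Proof.
rewrite /conjugate image_comp; apply: eq_imagel => a _ /=.
by rewrite invgM !mulgA.
Qed.

Lemma conjugateI x A B : conjugate x (A `&` B) = conjugate x A `&` conjugate x B.
Proof.
apply/seteqP; split=> [_ [a [Aa Ba] <-]|_ [[a Aa <-] [b Bb]]].
  by split; exists a.
by move=> /mulIg/mulgI ba; exists a => //; split=> //; rewrite -ba.
Qed.

Lemma conjugateK x A : conjugate x^-1%g (conjugate x A) = A.
Proof.
rewrite -conjugateM mulVg /conjugate -[RHS]image_id.
by apply: eq_imagel => a _; rewrite mul1g invg1 mulg1.
Qed.

Lemma lcosets_conjugate x A B :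
  lcosets (conjugate x A) (conjugate x B) = conjugate x @` lcosets A B.
Proof.
rewrite /lcosets {2}/conjugate !image_comp.
apply: eq_imagel => a _ /=; rewrite /lcoset /conjugate !image_comp.
by apply: eq_imagel => b _ /=; rewrite !mulgA mulgVK.
Qed.

Lemma index_conjugate x A B : index (conjugate x A) (conjugate x B) = index A B.
Proof.
rewrite /index lcosets_conjugate.
have [fin|inf] := pselect (finite_set (lcosets A B)).
  rewrite fset_set_image// card_imfset//=.
  exact: can_inj (conjugateK x).
have inf' : ~ finite_set (conjugate x @` lcosets A B).
  move=> /(finite_image (conjugate x^-1%g)); rewrite image_comp.
  rewrite (_ : _ @` _ = lcosets A B)//.
  by rewrite -[RHS]image_id; apply: eq_imagel => C _ /=; exact: conjugateK.
by rewrite /fset_set; case: pselect => // _; case: pselect.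
Qed.

End HeckePairs.

Lemma esumZ_le (R : realType) (T : choiceType) (D : set T) (a : T -> \bar R)
    (c : R) : 0 <= c -> (forall i, (0 <= a i)%E) ->
  (\esum_(i in D) (c%:E * a i) <= c%:E * \esum_(i in D) a i)%E.
Proof.
move=> c0 a0; apply: ge_ereal_sup => _ [X [finX XD] <-].
by rewrite -ge0_mule_fsumr// lee_wpmul2l ?lee_fin// esum_ge//; exists X.
Qed.

Section HeckeTriples.
Variables (R : realType) (G : groupType) (V : vectType R[i]).
Variables (dot : {dot V for Num.Def.conjC}) (H : set G).

(* A representation of H is given by a function on G; its values off H are
   irrelevant. *)
Variable sigma : G -> 'End(V).

(* As the sigma h are invertible, preserving the inner product means unitary. *)
Definition unitary_rep : Prop :=
  [/\ sigma 1%g = \1%VF,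
      forall h k, H h -> H k -> sigma (h * k)%g = (sigma h \o sigma k)%VF
    & forall h, H h -> isometry dot dot (sigma h)].

Definition rep_ker : set G := [set h | H h /\ sigma h = \1%VF].

Definition hecke_triple (n : nat) : Prop :=
  [/\ hecke_pair H, \dim {:V} = n, unitary_rep & finite_set (sigma @` H)].

Definition reduced_hecke_triple (n : nat) : Prop :=
  hecke_triple n /\ reduced_hecke_pair rep_ker.

Definition hecke_algebra : set (G -> 'End(V)) :=
  [set f | (forall h x k, H h -> H k ->
              f (h * x * k)%g = (sigma h \o f x \o sigma k)%VF)
         /\ finite_set (dcoset H @` [set x | f x != 0])].

Definition normsq (v : V) : R := complex.Re (dot v v).

Definition is_l2 (xi : G -> V) : Prop :=
  (forall x h, H h -> xi (x * h)%g = sigma h^-1%g (xi x)) /\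
  (\esum_(C in lcosets setT H) (normsq (xi (repr C)))%:E < +oo)%E.

Lemma normsq_ge0 v : 0 <= normsq v.
Proof. by rewrite /normsq; have := dnorm_ge0 dot v; case: (dot v v) => a b /andP[]. Qed.

Lemma normsqZ a v : normsq (a *: v) = complex.Re (`|a| ^+ 2) * normsq v.
Proof.
rewrite /normsq dnormZ.
have /complex_realP[r ->] : `|a| ^+ 2 \is Num.real by rewrite realX// normr_real.
by case: (dot v v) => c d /=; rewrite mul0r subr0.
Qed.

Lemma normsqD u v : normsq (u + v) <= 2 * (normsq u + normsq v).
Proof.
have := normsq_ge0 (u - v); rewrite /normsq.
have /= -> := dnormB dot u v; have /= -> := dnormD dot u v.
by rewrite !raddfB !raddfD /= => ?; lra.
Qed.

Lemma normsq_sum (I : Type) (r : seq I) (F : I -> V) :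
  normsq (\sum_(i <- r) F i) <= 2 ^+ size r * \sum_(i <- r) normsq (F i).
Proof.
elim: r => [|i r IH]; first by rewrite !big_nil /normsq linear0l mulr0.
rewrite !big_cons /=; apply: le_trans (normsqD _ _) _.
rewrite exprS -mulrA ler_pM2l// mulrDr lerD//.
by rewrite ler_peMl ?normsq_ge0// exprn_ege1// ler1n.
Qed.

Lemma dot_basisE : exists s : seq (V * V),
  forall f : 'End(V), forall u : V, f u = \sum_(p <- s) dot u p.1 *: f p.2.
Proof.
pose n := \dim {:V}; pose b := vbasis {:V}.
pose A : 'M[R[i]]_n := \matrix_(i, j) dot b`_i b`_j.
have uE v : v = \sum_(i < n) coord b i v *: b`_i by exact: coord_vbasis (memvf v).
have Au : A \in unitmx.
  rewrite -row_free_unit; apply: inj_row_free => v vA0.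
  pose w := \sum_(i < n) v 0 i *: b`_i.
  have wb j : dot w b`_(j : 'I_n) = 0.
    have /rowP/(_ j) := vA0; rewrite !mxE => <-.
    rewrite linear_sumlz; apply: eq_bigr => i _.
    by rewrite mxE linearZl_LR.
  have w0 : w = 0.
    apply/eqP; rewrite -(dnorm_eq0 dot) {2}(uE w) linear_sumr big1// => i _.
    by rewrite linearZr_LR /= wb mulr0.
  apply/rowP => i; rewrite mxE.
  by have /freeP := basis_free (vbasisP {:V}); apply.
pose w j := \sum_(i < n) invmx A j i *: b`_i.
exists [seq (b`_(nat_of_ord j), w j) | j <- enum 'I_n] => f v.
rewrite big_map big_enum /= {1}(uE v) linear_sum.
have cE i : coord b i v = \sum_j dot v b`_(j : 'I_n) * invmx A j i.
  pose c : 'rV_n := \row_i coord b i v.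
  have : c *m A *m invmx A = c by rewrite mulmxK.
  move/rowP/(_ i); rewrite mxE [RHS]mxE => <-; apply: eq_bigr => j _; congr (_ * _).
  rewrite mxE {1}(uE v) linear_sumlz; apply: eq_bigr => k _.
  by rewrite !mxE linearZl_LR.
transitivity (\sum_(i < n) \sum_(j < n) (dot v b`_j * invmx A j i) *: f b`_i).
  by apply: eq_bigr => i _; rewrite linearZ /= cE scaler_suml.
rewrite exchange_big; apply: eq_bigr => j _.
rewrite linear_sum scaler_sumr; apply: eq_bigr => i _.
by rewrite linearZ scalerA.
Qed.

Lemma dot_normsq v : dot v v = (normsq v)%:C.
Proof.
rewrite /normsq; have := dnorm_ge0 dot v.
by case: (dot v v) => a b /andP[/eqP /= -> _].
Qed.

Lemma normsq_dotZ u v w :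
  normsq (dot u v *: w) <= normsq v * normsq w * normsq u.
Proof.
rewrite normsqZ [leRHS]mulrC mulrA ler_wpM2r ?normsq_ge0//.
have [+ _] := CauchySchwarz dot u v.
by rewrite !dot_normsq -rmorphM /= lecE => /andP[_ /=]; rewrite mulrC.
Qed.

Lemma normsq_lfun (f : 'End(V)) :
  exists2 M, 0 <= M & forall v, normsq (f v) <= M * normsq v.
Proof.
have [s sE] := dot_basisE.
exists (2 ^+ size s * \sum_(p <- s) normsq p.1 * normsq (f p.2)).
  by rewrite mulr_ge0 ?exprn_ge0// sumr_ge0// => p _; rewrite mulr_ge0 ?normsq_ge0.
move=> v; rewrite sE (le_trans (normsq_sum _ _))// -mulrA ler_pM2l ?exprn_gt0//.
by rewrite mulr_suml ler_sum// => p _; exact: normsq_dotZ.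
Qed.

Definition l2_pred : {pred G -> V} := [pred xi | `[< is_l2 xi >]].

Lemma l2_submod_closed : submod_closed l2_pred.
Proof.
split=> [|a xi eta].
  apply/asboolP; split=> [x h _|]; first by rewrite linear0.
  rewrite esum1 ?ltry// => C _ /=.
  by rewrite /normsq linear0l.
move=> /asboolP[xic xis] /asboolP[etac etas]; apply/asboolP; split=> [x h Hh|].
  by rewrite !fctE /= xic// etac// linearP.
pose M := 2 * (complex.Re (`|a| ^+ 2) + 1) : R.
have M0 : 0 <= complex.Re (`|a| ^+ 2).
  by have : 0 <= `|a| ^+ 2 by []; case: (`|a| ^+ 2) => ? ? /andP[].
have lM : (M%:E * (\esum_(C in lcosets setT H) (normsq (xi (repr C)))%:E +
    \esum_(C in lcosets setT H) (normsq (eta (repr C)))%:E) < +oo)%E.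
  by rewrite lte_mul_pinfty ?lte_add_pinfty// lee_fin /M; lra.
apply: le_lt_trans lM; rewrite -esumD; [|by move=> *; rewrite lee_fin normsq_ge0..].
apply: le_trans (esumZ_le _ _ _); first last.
- by move=> C; rewrite -EFinD lee_fin addr_ge0 ?normsq_ge0.
- by rewrite /M; lra.
apply: le_esum => C _; rewrite -EFinD -EFinM lee_fin.
apply: (le_trans (normsqD _ _)); rewrite /M -mulrA ler_pM2l// normsqZ.
have := normsq_ge0 (xi (repr C)); have := normsq_ge0 (eta (repr C)).
nra.
Qed.

HB.instance Definition _ :=
  GRing.isSubmodClosed.Build _ _ l2_pred l2_submod_closed.

Record l2 : Type := L2 { l2_fun :> G -> V; _ : l2_fun \in l2_pred }.

HB.instance Definition _ := [isSub for l2_fun].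
HB.instance Definition _ := [Choice of l2 by <:].
HB.instance Definition _ := [SubChoice_isSubLmodule of l2 by <:].

Definition l2_norm (xi : l2) : R :=
  Num.sqrt (fine (\esum_(C in lcosets setT H) (normsq (xi (repr C)))%:E)).

(* Meaningful for absolutely summable families only. *)
Definition rsum (T : choiceType) (D : set T) (a : T -> R) : R :=
  fine (\esum_(i in D) (Num.max (a i) 0)%:E) -
  fine (\esum_(i in D) (Num.max (- a i) 0)%:E).

Definition csum (T : choiceType) (D : set T) (a : T -> R[i]) : R[i] :=
  rsum D (fun i => complex.Re (a i)) +i* rsum D (fun i => complex.Im (a i)).

Definition l2_dot (xi eta : l2) : R[i] :=
  csum (lcosets setT H) (fun C => dot (xi (repr C)) (eta (repr C))).

Definition lambda_fun (x : G) (xi : G -> V) : G -> V :=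
  fun y => xi (x^-1 * y)%g.

Definition Rtilde_fun (f : G -> 'End(V)) (xi : G -> V) : G -> V :=
  fun y => \sum_(C \in lcosets setT H)
    (Num.sqrt (modular R rep_ker (repr C)))%:C *: f (repr C) (xi (y * repr C)%g).


Section Translations.
Hypothesis Hgrp : group_closed (mem H).
Hypothesis sigmaU : unitary_rep.

Lemma normsq_sigma h v : H h -> normsq (sigma h v) = normsq v.
Proof. by move=> Hh; case: sigmaU => _ _ iso; rewrite /normsq iso. Qed.

Lemma normsq_equivariant xi : (forall x h, H h -> xi (x * h)%g = sigma h^-1%g (xi x)) ->
  forall y, normsq (xi y) = normsq (xi (repr (lcoset y H))).
Proof.
move=> xiE y; have [h Hh ->] := repr_lcoset Hgrp y.
by rewrite xiE// normsq_sigma//; exact: grpV.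
Qed.

Lemma lambda_fun_l2 x xi : is_l2 xi -> is_l2 (lambda_fun x xi).
Proof.
move=> [xiE xis]; split=> [y h Hh|]; first by rewrite /lambda_fun mulgA xiE.
rewrite (reindex_esum (lcosets setT H) _ _ _ (lcoset_translate_bij Hgrp x^-1)) in xis.
rewrite (eq_esum (b := fun C => (normsq (xi (repr (lcoset (x^-1 * repr C)%g H))))%:E))//.
by move=> C _; rewrite -normsq_equivariant.
Qed.


Lemma rep_kerJ h : H h -> conjugate h rep_ker = rep_ker.
Proof.
suff sub g : H g -> conjugate g rep_ker `<=` rep_ker.
  move=> Hh; apply/seteqP; split; first exact: sub.
  rewrite -[X in X `<=` _](conjugateK h^-1%g) invgK => _ [k Kk <-].
  by exists k => //; apply: sub Kk; exact: grpV.
move=> Hg _ [k [Hk k1] <-]; case: sigmaU => s1 sM _; split.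
  by apply: grpM => //; [exact: grpM|exact: grpV].
rewrite sM//; [|exact: grpM|exact: grpV].
by rewrite sM// k1 comp_lfun1r -sM ?mulgV//; exact: grpV.
Qed.

Lemma modularMr x h : H h -> modular R rep_ker (x * h)%g = modular R rep_ker x.
Proof.
move=> Hh; rewrite /modular conjugateM rep_kerJ//; congr (_ / _%:R).
rewrite invgM conjugateM -[X in index X _](rep_kerJ (grpV Hgrp Hh)).
by rewrite -[X in _ (_) (X `&` _)](rep_kerJ (grpV Hgrp Hh)) -conjugateI index_conjugate.
Qed.

Lemma modularMl x h : H h -> modular R rep_ker (h * x)%g = modular R rep_ker x.
Proof.
move=> Hh; rewrite /modular invgM !conjugateM (rep_kerJ (grpV Hgrp Hh)); congr (_%:R / _).
by rewrite -{1 2}(rep_kerJ Hh) -conjugateI index_conjugate.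
Qed.


Lemma translate_bound z : finite_set (lcosets H (H `&` conjugate z^-1%g H)) ->
  exists2 k : R, 0 <= k & forall N : set G -> R, (forall C, 0 <= N C) ->
  (\esum_(C in lcosets setT H) (N (lcoset (repr C * z)%g H))%:E <=
   k%:E * \esum_(C in lcosets setT H) (N C)%:E)%E.
Proof.
set S := lcosets H _ => finS; exists (\sum_(B <- fset_set S) 1).
  by rewrite sumr_ge0.
move=> N N0; pose phi C := lcoset (repr C * z)%g H.
pose psi B W := lcoset (repr W * repr B * z^-1)%g H.
have phiK C : lcosets setT H C -> exists2 B, S B & psi B (phi C) = C.
  move=> CH; have [h Hh e] := repr_lcoset Hgrp (repr C * z)%g.
  exists (lcoset h^-1%g (H `&` conjugate z^-1%g H)).
    by exists h^-1%g => //; exact: grpV.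
  have [l [Hl [l' Hl' l'E]] lE] : lcoset h^-1%g (H `&` conjugate z^-1%g H)
      (repr (lcoset h^-1%g (H `&` conjugate z^-1%g H))).
    apply: xgetPex; exists (h^-1 * 1)%g; exists 1%g => //; split; first exact: grp1.
    by exists 1%g; [exact: grp1|rewrite mulg1 invgK mulVg].
  rewrite /psi /phi -lE e -l'E invgK -[RHS](lcoset_repr Hgrp CH).
  rewrite -[RHS](lcosetMr Hgrp _ Hl'); congr (lcoset _ H).
  by rewrite !mulgA mulgK mulgK mulgK.
have -> : ((\sum_(B <- fset_set S) 1)%:E * (\esum_(C in lcosets setT H) (N C)%:E) =
    \sum_(B <- fset_set S) \esum_(C in lcosets setT H) (N C)%:E)%E.
  by rewrite -sumEFin ge0_sume_distrl//; apply: eq_bigr => *; rewrite mul1e.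
apply: (@le_trans _ _ (\sum_(B <- fset_set S) \esum_(C in lcosets setT H)
   (if C \in [set C | psi B (phi C) = C] then (N (phi C))%:E else 0))%E).
  rewrite -esum_sum; last by move=> *; case: ifP; rewrite ?lee_fin.
  apply: le_esum => C CH; have [B SB BE] := phiK C CH.
  rewrite (big_rem B) /=; last by rewrite in_fset_set// mem_set.
  rewrite mem_set// leeDl// sume_ge0// => *.
  by case: ifP; rewrite ?lee_fin.
apply: lee_sum => B _; rewrite -esum_mkcondr.
rewrite -(@reindex_esum _ _ _ _ (phi @` (lcosets setT H `&` [set C | psi B (phi C) = C])) phi (fun W => (N W)%:E)); last first.
  split; [by move=> C ?; exists C| |by []].
  by move=> C D /set_mem[_ /= {2}<-] /set_mem[_ /= {2}<-] ->.
rewrite esum_mkcond [leRHS]esum_mkcond.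
apply: le_esum => W _; case: ifPn => [/set_mem[C [CH _] <-]|_].
  by rewrite mem_set//; exact: lcosets_lcoset.
by case: ifP; rewrite ?lee_fin.
Qed.


Hypothesis Hhecke : forall x, finite_set (lcosets H (H `&` conjugate x H)).
Variable f : G -> 'End(V).
Hypothesis Hf : hecke_algebra f.

Let term (xi : G -> V) y z : V :=
  (Num.sqrt (modular R rep_ker z))%:C *: f z (xi (y * z)%g).

Let supp : set (set G) := [set C | lcosets setT H C /\ f (repr C) != 0].

Lemma hecke_supp_finite : finite_set supp.
Proof.
have [_ finD] := Hf.
pose g (D B : set G) := lcoset (repr B * repr D)%g H.
apply: sub_finite_set (bigcup_finite (F := fun D =>
  g D @` lcosets H (H `&` conjugate (repr D) H)) finD _); last first.
  by move=> D _; apply: finite_image; exact: Hhecke.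
move=> C [CH fC]; exists (dcoset H (repr C)); first by exists (repr C).
have [h Hh [k Hk e]] : dcoset H (repr C) (repr (dcoset H (repr C))).
  apply: xgetPex; exists (repr C); exists 1%g; first exact: grp1.
  by exists 1%g; [exact: grp1|rewrite mul1g mulg1].
set x := repr (dcoset H (repr C)) in e *.
exists (lcoset h^-1%g (H `&` conjugate x H)).
  by exists h^-1%g => //; exact: grpV.
have [l [Hl [l' Hl' l'E]] lE] : lcoset h^-1%g (H `&` conjugate x H)
    (repr (lcoset h^-1%g (H `&` conjugate x H))).
  apply: xgetPex; exists (h^-1 * 1)%g; exists 1%g => //; split; first exact: grp1.
  by exists 1%g; [exact: grp1|rewrite mulg1 mulgV].
rewrite /g -lE -l'E -[RHS](lcoset_repr Hgrp CH).
rewrite -[RHS](lcosetMr Hgrp _ (grpM Hgrp Hk Hl')); congr (lcoset _ H).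
by rewrite !mulgA mulgVK -e !mulgA mulVg mul1g.
Qed.

Lemma Rtilde_fun_supp xi y :
  Rtilde_fun f xi y = \sum_(C <- fset_set supp) term xi y (repr C).
Proof.
rewrite -fsbig_finite; last exact: hecke_supp_finite.
apply/esym/fsbig_widen; first by move=> C [].
move=> C [CH] /not_andP[//|/negP]; rewrite negbK => /eqP fC.
by rewrite /preimage /= /term fC lfunE /= scaler0.
Qed.

Lemma Rtilde_fun_bound : exists2 M : R, 0 <= M & forall xi,
  (forall x h, H h -> xi (x * h)%g = sigma h^-1%g (xi x)) ->
  (\esum_(C in lcosets setT H) (normsq (Rtilde_fun f xi (repr C)))%:E <=
   M%:E * \esum_(C in lcosets setT H) (normsq (xi (repr C)))%:E)%E.
Proof.
have /choice[c cP] : forall C, exists c : R, 0 <= c /\ forall xi,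
    (forall x h, H h -> xi (x * h)%g = sigma h^-1%g (xi x)) ->
    (\esum_(D in lcosets setT H) (normsq (term xi (repr D) (repr C)))%:E <=
     c%:E * \esum_(D in lcosets setT H) (normsq (xi (repr D)))%:E)%E.
  move=> C.
  have [M M0 MP] := normsq_lfun ((Num.sqrt (modular R rep_ker (repr C)))%:C *: f (repr C)).
  have [k k0 kP] := translate_bound (Hhecke (repr C)^-1%g).
  exists (M * k); split=> [|xi xiE]; first exact: mulr_ge0.
  rewrite EFinM -muleA.
  apply: le_trans (lee_wpmul2l _ (kP (fun D => normsq (xi (repr D))) _)); last 2 first.
  - by rewrite lee_fin.
  - by move=> D; exact: normsq_ge0.
  apply: le_trans (esumZ_le _ _ _) => //; last by move=> D; rewrite lee_fin normsq_ge0.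
  apply: le_esum => D _; rewrite -EFinM lee_fin -normsq_equivariant//.
  by apply: le_trans (MP _); rewrite lfunE.
pose n := size (fset_set supp).
exists (2 ^+ n * \sum_(C <- fset_set supp) c C).
  by rewrite mulr_ge0 ?exprn_ge0 ?sumr_ge0// => C _; case: (cP C).
move=> xi xiE; rewrite EFinM -muleA -sumEFin ge0_sume_distrl; last first.
  by move=> C _; rewrite lee_fin; case: (cP C).
apply: (@le_trans _ _ ((2 ^+ n)%:E * (\sum_(C <- fset_set supp)
   \esum_(D in lcosets setT H) (normsq (term xi (repr D) (repr C)))%:E))%E); last first.
  rewrite lee_wpmul2l ?lee_fin ?exprn_ge0//.
  by apply: lee_sum => C _; case: (cP C) => _; exact.
rewrite -esum_sum; last by move=> *; rewrite lee_fin normsq_ge0.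
apply: le_trans (esumZ_le _ _ _); last 2 first.
- by rewrite exprn_ge0.
- by move=> D; apply: sume_ge0 => *; rewrite lee_fin normsq_ge0.
apply: le_esum => D _; rewrite sumEFin -EFinM lee_fin Rtilde_fun_supp.
exact: normsq_sum.
Qed.

Lemma Rtilde_fun_l2 xi : is_l2 xi -> is_l2 (Rtilde_fun f xi).
Proof.
move=> [xiE xis]; have [fE _] := Hf; case: (sigmaU) => s1 sM _; split; last first.
  have [M M0 MP] := Rtilde_fun_bound.
  by apply: le_lt_trans (MP _ xiE) _; rewrite lte_mul_pinfty ?lee_fin.
move=> y h Hh; have HhV := grpV Hgrp Hh.
have sK v : sigma h^-1%g (sigma h v) = v.
  by rewrite -comp_lfunE -sM// mulVg s1 id_lfunE.
have termMl z : sigma h (term xi (y * h)%g z) = term xi y (h * z)%g.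
  rewrite /term linearZ /= modularMl// mulgA; congr (_ *: _).
  have := fE h z 1%g Hh (grp1 Hgrp); rewrite mulg1 s1 comp_lfun1r => ->.
  by rewrite comp_lfunE.
have termMr z k : H k -> term xi y (z * k)%g = term xi y z.
  move=> Hk; rewrite /term modularMr// mulgA (xiE _ _ Hk); congr (_ *: _).
  have := fE 1%g z k (grp1 Hgrp) Hk; rewrite mul1g s1 comp_lfun1l => ->.
  rewrite comp_lfunE -[sigma k _]comp_lfunE -sM//; last exact: grpV.
  by rewrite mulgV s1 id_lfunE.
have -> : Rtilde_fun f xi y = \sum_(C \in lcosets setT H) sigma h (term xi (y * h)%g (repr C)).
  rewrite [LHS](reindex_fsbig _ _ _ _ (lcoset_translate_bij Hgrp h)).
  apply: eq_fsbigr => C _; rewrite termMl.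
  have [k Hk ->] := repr_lcoset Hgrp (h * repr C)%g.
  exact: termMr.
rewrite -(@fsbig_widen _ _ _ _ supp); first last.
- move=> C [CH] /not_andP[//|/negP]; rewrite negbK => /eqP fC.
  by rewrite /preimage /= /term fC lfunE /= scaler0 linear0.
- by move=> C [].
rewrite fsbig_finite; last exact: hecke_supp_finite.
by rewrite -linear_sum /= sK Rtilde_fun_supp.
Qed.

End Translations.

(* Under [hecke_triple] the default value 0 of [insubd] is never used, see
   [lambdaE] and [RtildeE]. *)
Definition lambda (x : G) (xi : l2) : l2 := insubd 0 (lambda_fun x xi).

Definition Rtilde (f : G -> 'End(V)) (xi : l2) : l2 := insubd 0 (Rtilde_fun f xi).

Lemma lambdaE n x (xi : l2) : hecke_triple n ->
  lambda x xi = lambda_fun x xi :> (G -> V).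
Proof.
case=> -[Hgrp _] _ sigmaU _; apply: insubdK; apply/asboolP.
by apply: lambda_fun_l2 => //; case: xi => xi /= /asboolP.
Qed.

Lemma RtildeE n f (xi : l2) : hecke_triple n -> hecke_algebra f ->
  Rtilde f xi = Rtilde_fun f xi :> (G -> V).
Proof.
case=> -[Hgrp Hhecke] _ sigmaU _ Hf; apply: insubdK; apply/asboolP.
by apply: Rtilde_fun_l2 => //; case: xi => xi /= /asboolP.
Qed.

Definition bounded_op : set (l2 -> l2) :=
  [set T | linear T /\ exists M : R, forall xi, l2_norm (T xi) <= M * l2_norm xi].

Definition commutant (S : set (l2 -> l2)) : set (l2 -> l2) :=
  [set T | bounded_op T /\ forall A, S A -> T \o A = A \o T].

Definition adjoint (A B : l2 -> l2) : Prop :=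
  forall xi eta, l2_dot (A xi) eta = l2_dot xi (B eta).

Definition star_subalgebra (M : set (l2 -> l2)) : Prop :=
  [/\ M `<=` bounded_op,
      M 0,
      forall (a : R[i]) A B, M A -> M B -> M (a *: A + B),
      forall A B, M A -> M B -> M (A \o B)
    & forall A B, M A -> bounded_op B -> adjoint A B -> M B].

(* Dixmier's definition: a *-subalgebra equal to its bicommutant. *)
Definition von_neumann_algebra (M : set (l2 -> l2)) : Prop :=
  star_subalgebra M /\ commutant (commutant M) = M.

Definition von_neumann_generated (S : set (l2 -> l2)) : set (l2 -> l2) :=
  \bigcap_(M in [set M | von_neumann_algebra M /\ S `<=` M]) M.

End HeckeTriples.

Arguments lambda {R G V} dot H sigma x xi.
Arguments Rtilde {R G V} dot H sigma f xi.

(* Main.v *)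
(* For [v] in [V] let [delta_v] be the vector of l^2(G,H,sigma) supported on [H]
   with [delta_v 1 = v].  An operator [T] commuting with [lambda(G)] is right
   convolution by its symbol [z |-> (v |-> (T delta_v)(z^-1))].  Cutting this
   symbol off outside a finite, left [H]-stable set [A] of cosets gives, up to
   the factor [Delta^(1/2)], an element [F_A] of the Hecke algebra with
   [(Rtilde F_A xi)(y) = T (1_A lambda(y^-1) xi) (1)]; on a translate of
   [delta_v] this operator is a cut-off of [T].  Hence [Rtilde F_A] tends to [T]
   in norm on the translates of the [delta_v] and pointwise on all of l^2, so
   every bounded [S] commuting with the [Rtilde F_A] satisfies [ST = TS] on
   these translates, which span a dense subspace.  Thus [lambda(G)'] is
   contained in [Rtilde(Hecke)'']. *)
From HB Require Import structures.
Require Import Defs.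
From mathcomp Require Import all_boot all_order all_algebra.
From mathcomp Require Import all_classical all_reals all_analysis.
From mathcomp Require Import complex finmap lra.
Set Implicit Arguments.
Unset Strict Implicit.
Unset Printing Implicit Defensive.
Import Order.TTheory GRing.Theory Num.Theory.
Local Open Scope classical_set_scope.
Local Open Scope ring_scope.

(** * Squared norms on l^2 and bounded operators *)

Section SquareNorm.
Variables (R : realType) (G : groupType) (V : vectType R[i]).
Variables (dot : {dot V for Num.Def.conjC}) (H : set G) (sigma : G -> 'End(V)).
Local Notation L2 := (l2 dot H sigma).
Local Notation GH := (lcosets [set: G] H).
Implicit Types (xi eta : L2) (T S : L2 -> L2).

(** The square of [l2_norm xi]. The estimates below bound squares, with [l2_sqD] in the role of the
    triangle inequality. *)
Definition l2_sq xi : R :=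
  fine (\esum_(C in GH) (normsq dot (xi (Defs.repr C)))%:E).

Lemma l2_is_l2 xi : is_l2 dot H sigma xi.
Proof. by case: xi => f /= /asboolP. Qed.

Lemma l2_ext xi eta : (forall y, xi y = eta y) -> xi = eta.
Proof. by move=> e; apply: val_inj; apply/funext. Qed.

Lemma l2_addE xi eta y : (xi + eta) y = xi y + eta y.
Proof. by []. Qed.

Lemma l2_oppE xi y : (- xi) y = - xi y.
Proof. by []. Qed.

Lemma l2_scaleE a xi y : (a *: xi) y = a *: xi y.
Proof. by []. Qed.

Lemma l2_zeroE y : (0 : L2) y = 0.
Proof. by []. Qed.

Lemma l2_sumE (I : Type) (r : seq I) (F : I -> L2) y :
  (\sum_(i <- r) F i) y = \sum_(i <- r) F i y.
Proof.
elim: r => [|i r IH]; first by rewrite !big_nil.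
by rewrite !big_cons l2_addE IH.
Qed.

Lemma l2_sqE xi :
  (l2_sq xi)%:E = (\esum_(C in GH) (normsq dot (xi (Defs.repr C)))%:E)%E.
Proof.
have [_ fin] := l2_is_l2 xi; rewrite fineK// ge0_fin_numE//.
by apply: esum_ge0 => C _; rewrite lee_fin normsq_ge0.
Qed.

Lemma l2_sq_ge0 xi : 0 <= l2_sq xi.
Proof.
by apply/fine_ge0/esum_ge0 => C _; rewrite lee_fin normsq_ge0.
Qed.

Lemma l2_sq0 : l2_sq 0 = 0.
Proof.
apply: EFin_inj; rewrite l2_sqE; apply: esum1 => C _.
by rewrite l2_zeroE /normsq linear0l.
Qed.

Lemma l2_sqD xi eta : l2_sq (xi + eta) <= 2 * (l2_sq xi + l2_sq eta).
Proof.
rewrite -lee_fin l2_sqE EFinM (EFinD (l2_sq xi)) !l2_sqE -esumD; last 2 first.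
- by move=> *; rewrite lee_fin normsq_ge0.
- by move=> *; rewrite lee_fin normsq_ge0.
apply: le_trans (esumZ_le _ _ _) => //; last first.
  by move=> C; rewrite -EFinD lee_fin addr_ge0 ?normsq_ge0.
by apply: le_esum => C _; rewrite -EFinD -EFinM lee_fin normsqD.
Qed.

Lemma normsqN v : normsq dot (- v) = normsq dot v.
Proof. by rewrite -scaleN1r normsqZ normrN1 expr1n mul1r. Qed.

Lemma l2_sqN xi : l2_sq (- xi) = l2_sq xi.
Proof.
by rewrite /l2_sq; congr fine; apply: eq_esum => C _; rewrite l2_oppE normsqN.
Qed.

Lemma normsqB u v : normsq dot (u - v) <= 2 * (normsq dot u + normsq dot v).
Proof. by rewrite -(normsqN v) normsqD. Qed.

Lemma normsq_eq0 v : normsq dot v = 0 -> v = 0.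
Proof. by move=> v0; apply/eqP; rewrite -(dnorm_eq0 dot) dot_normsq v0. Qed.

Lemma l2_sqZ a xi : l2_sq (a *: xi) <= complex.Re (`|a| ^+ 2) * l2_sq xi.
Proof.
have a0 : 0 <= complex.Re (`|a| ^+ 2).
  by have : 0 <= `|a| ^+ 2 by []; case: (`|a| ^+ 2) => ? ? /andP[].
rewrite -lee_fin l2_sqE EFinM l2_sqE.
apply: le_trans (esumZ_le _ _ _) => //; last first.
  by move=> C; rewrite lee_fin normsq_ge0.
by apply: le_esum => C _; rewrite -EFinM lee_fin l2_scaleE normsqZ.
Qed.

Lemma bounded_opP T : bounded_op T <->
  linear T /\ exists2 M, 0 <= M & forall xi, l2_sq (T xi) <= M * l2_sq xi.
Proof.
split=> -[linT [M]].
  move=> MP; split=> //; exists (M ^+ 2) => [|xi]; first exact: sqr_ge0.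
  have := MP xi; rewrite /l2_norm -/(l2_sq xi) -/(l2_sq (T xi)) => le.
  rewrite -[leLHS]sqr_sqrtr ?l2_sq_ge0// -[l2_sq xi]sqr_sqrtr ?l2_sq_ge0//.
  rewrite -exprMn ler_pXn2r// nnegrE ?sqrtr_ge0//.
  (* [M] itself may be negative, but its product with the norm of [xi] is not, as it bounds the norm
     of [T xi]. *)
  exact: le_trans (sqrtr_ge0 _) le.
move=> M0 MP; split=> //; exists (Num.sqrt M) => xi.
by rewrite /l2_norm -sqrtrM// ler_wsqrtr//; exact: MP.
Qed.

Lemma bounded_op_lin a T S :
  bounded_op T -> bounded_op S -> bounded_op (a *: T + S).
Proof.
move=> /bounded_opP[linT [M M0 MP]] /bounded_opP[linS [N N0 NP]].
apply/bounded_opP; split.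
  move=> b xi eta; rewrite !fctE linT linS scalerDr !scalerA mulrC -scalerA.
  by rewrite scalerDr -!addrA; congr (_ + _); rewrite addrCA.
pose c := complex.Re (`|a| ^+ 2).
have c0 : 0 <= c.
  by rewrite /c; have : 0 <= `|a| ^+ 2 by []; case: (`|a| ^+ 2) => ? ? /andP[].
exists (2 * (c * M + N)) => [|xi]; first by rewrite mulr_ge0// addr_ge0// mulr_ge0.
rewrite !fctE (le_trans (l2_sqD _ _))// -mulrA ler_pM2l// mulrDl lerD//.
by apply: (le_trans (l2_sqZ _ _)); rewrite -mulrA ler_wpM2l.
Qed.

Lemma bounded_op_comp T S : bounded_op T -> bounded_op S -> bounded_op (T \o S).
Proof.
move=> /bounded_opP[linT [M M0 MP]] /bounded_opP[linS [N N0 NP]].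
apply/bounded_opP; split; first by move=> a xi eta /=; rewrite linS linT.
exists (M * N) => [|xi /=]; first exact: mulr_ge0.
by rewrite (le_trans (MP _))// -mulrA ler_wpM2l.
Qed.

Lemma bounded_op_sub T S :
  bounded_op T -> bounded_op S -> bounded_op (fun xi => T xi - S xi).
Proof.
move=> bT bS; have := bounded_op_lin (-1) bS bT.
rewrite (_ : _ + T = fun xi => T xi - S xi)//.
by apply/funext => xi; rewrite !fctE scaleN1r addrC.
Qed.

Lemma linear_l2B T xi eta : linear T -> T (xi - eta) = T xi - T eta.
Proof. by move=> lT; have := lT (-1) eta xi; rewrite !scaleN1r ![- _ + _]addrC. Qed.

Lemma linear_l2_0 T : linear T -> T 0 = 0.
Proof. by move=> lT; have := linear_l2B 0 0 lT; rewrite !subrr. Qed.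

Lemma linear_l2_sum T (I : Type) (r : seq I) (F : I -> L2) : linear T ->
  T (\sum_(i <- r) F i) = \sum_(i <- r) T (F i).
Proof.
move=> lT; elim: r => [|i r IH]; first by rewrite !big_nil linear_l2_0.
by rewrite !big_cons -[F i]scale1r lT IH !scale1r.
Qed.

End SquareNorm.

(** The Hecke condition makes both indices finite, where an infinite one would be recorded as 0, and
    each counts at least the coset of 1. *)
Lemma modular_gt0 (R : realType) (G : groupType) (K : set G) (x : G) :
  hecke_pair K -> 0 < modular R K x.
Proof.
move=> [Kgrp finK].
have pos y : (0 < Defs.index K (K `&` conjugate y K))%N.
  rewrite /Defs.index cardfs_gt0; apply/fset0Pn.
  exists (lcoset 1%g (K `&` conjugate y K)).
  by rewrite in_fset_set// mem_set//; exists 1%g => //; exact: grp1.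
by rewrite /modular divr_gt0// ltr0n.
Qed.

Lemma esum_eq1 (R : realType) (T : choiceType) (D : set T) (a : T -> \bar R) c :
  D c -> (0 <= a c)%E -> (forall i, D i -> i != c -> a i = 0%E) ->
  (\esum_(i in D) a i = a c)%E.
Proof.
move=> Dc ac0 a0; rewrite -(esum_set1 ac0) [RHS]esum_mkcond esum_mkcond.
apply: eq_esum => i _; have [->|ic] := eqVneq i c; first by rewrite !mem_set.
rewrite (@memNset _ [set c]); last exact/eqP.
by case: ifPn => // /set_mem Di; exact: a0.
Qed.

Lemma linfunE (F : fieldType) (U W : vectType F) (f : U -> W) v :
  linear f -> linfun f v = f v.
Proof.
move=> linf; pose lf := GRing.isLinear.Build F U W *:%R f linf.
pose L : {linear U -> W} := HB.pack f lf.
exact: (lfunE L).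
Qed.

(** * Equivariant functions and the unitary representation lambda *)

Section InducedRepresentation.
Variables (R : realType) (G : groupType) (V : vectType R[i]) (n : nat).
Variables (dot : {dot V for Num.Def.conjC}) (H : set G) (sigma : G -> 'End(V)).
Hypothesis ht : hecke_triple dot H sigma n.
Local Notation L2 := (l2 dot H sigma).
Local Notation GH := (lcosets [set: G] H).
Local Notation lam := (lambda dot H sigma).
Implicit Types (xi eta : L2) (T S : L2 -> L2) (A : set (set G)).

Let Hgrp : group_closed (mem H). Proof. by case: ht => -[]. Qed.
Let Hfin x : finite_set (lcosets H (H `&` conjugate x H)).
Proof. by case: ht => -[_]. Qed.
Let sigmaU : unitary_rep dot H sigma. Proof. by case: ht. Qed.

Lemma sigmaM h k v : H h -> H k -> sigma (h * k)%g v = sigma h (sigma k v).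
Proof. by move=> Hh Hk; case: sigmaU => _ sM _; rewrite sM// comp_lfunE. Qed.

Lemma sigma1 v : sigma 1%g v = v.
Proof. by case: sigmaU => -> _ _; rewrite id_lfunE. Qed.

Lemma l2_equivariant xi x h : H h -> xi (x * h)%g = sigma h^-1%g (xi x).
Proof. by case: (l2_is_l2 xi) => e _; exact: e. Qed.

Lemma normsq_repr xi y :
  normsq dot (xi y) = normsq dot (xi (Defs.repr (lcoset y H))).
Proof.
by apply: (@normsq_equivariant _ _ _ _ _ _ Hgrp sigmaU xi) => *; exact: l2_equivariant.
Qed.

Lemma mem_grpMr x h : H h -> ((x * h)%g \in H) = (x \in H).
Proof.
move=> Hh; apply/idP/idP => /set_mem Hx; apply/mem_set; last exact: grpM.
by rewrite -[x](mulgK h); apply: grpM => //; exact: grpV.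
Qed.

Lemma mem_grpMl x h : H h -> ((h * x)%g \in H) = (x \in H).
Proof.
move=> Hh; apply/idP/idP => /set_mem Hx; apply/mem_set; last exact: grpM.
by rewrite -[x](mulKg h); apply: grpM => //; exact: grpV.
Qed.

Lemma lambdaEv x xi y : lam x xi y = xi (x^-1 * y)%g.
Proof. by rewrite (lambdaE x xi ht). Qed.

Lemma lambda_linear x : linear (lam x).
Proof.
by move=> a xi eta; apply: l2_ext => y; rewrite !(lambdaEv, l2_addE, l2_scaleE).
Qed.

Lemma l2_sq_lambda x xi : l2_sq (lam x xi) = l2_sq xi.
Proof.
apply: EFin_inj; rewrite !l2_sqE.
rewrite [RHS](reindex_esum _ _ _ _ (lcoset_translate_bij Hgrp x^-1%g)).
apply: eq_esum => C _; rewrite lambdaEv; congr (_%:E).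
exact: normsq_repr.
Qed.

Lemma lambda_bounded x : bounded_op (lam x).
Proof.
apply/bounded_opP; split; first exact: lambda_linear.
by exists 1 => // xi; rewrite mul1r l2_sq_lambda.
Qed.

(** The left side is one term of the sum. Point evaluations are thus bounded, and norm estimates
    pass to values. *)
Lemma normsq_le_l2_sq xi y : normsq dot (xi y) <= l2_sq xi.
Proof.
rewrite normsq_repr -lee_fin l2_sqE; apply: esum_ge; exists [set lcoset y H].
  by split; [exact: finite_set1|move=> _ ->; exact: lcosets_lcoset].
by rewrite fsbig_set1.
Qed.

(** * Cut-offs and delta vectors *)

Definition l2_restr A xi : L2 :=
  insubd 0 (fun y => if lcoset y H \in A then xi y else 0).

Lemma l2_restrE A xi y :
  l2_restr A xi y = if lcoset y H \in A then xi y else 0.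
Proof.
rewrite /l2_restr insubdK//; apply/asboolP; split=> [x h Hh|].
  by rewrite lcosetMr// l2_equivariant//; case: ifP; rewrite ?linear0.
have [_] := l2_is_l2 xi; apply: le_lt_trans; apply: le_esum => C _.
by rewrite lee_fin; case: ifP => // _; rewrite {1}/normsq linear0l normsq_ge0.
Qed.

(** [A0] carries the sum of squares up to [e]. The larger [A] may be infinite and contain sets that
    are not cosets, which suits the set in [Rtilde_symbol_delta]. *)
Lemma l2_restr_tail xi (e : R) : 0 < e ->
  exists A0, [/\ finite_set A0, A0 `<=` GH &
    forall A, A0 `<=` A -> l2_sq (xi - l2_restr A xi) <= e].
Proof.
move=> e0; pose a C := (normsq dot (xi (Defs.repr C)))%:E.
have a0 C : (0 <= a C)%E by rewrite lee_fin normsq_ge0.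
have aE := l2_sqE xi.
have fin : (\esum_(C in GH) a C)%E \is a fin_num by rewrite -aE.
have [_ [A0 [finA0 subA0] <-] lt] := ub_ereal_sup_adherent e0 fin.
exists A0; split=> // A subA.
apply: (@le_trans _ _ (fine (\esum_(C in GH `&` ~` A0) a C)%E)).
  apply: fine_le.
  - by rewrite -l2_sqE.
  - rewrite ge0_fin_numE ?esum_ge0//; move: fin; rewrite ge0_fin_numE ?esum_ge0//.
    apply: le_lt_trans; rewrite [leRHS](esumID A0)// leeDr// esum_ge0//.
  - rewrite [leRHS]esum_mkcondr; apply: le_esum => C CH.
    rewrite l2_addE l2_oppE l2_restrE (lcoset_repr Hgrp CH).
    case: ifPn => [_|/negP CA]; first by rewrite subrr {1}/normsq linear0l; case: ifP.
    by rewrite subr0 mem_set// => /subA /mem_set.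
have S_fin : (\esum_(C in A0) a C)%E \is a fin_num.
  rewrite esum_fset// fsbig_finite//=; apply/sum_fin_numP => *; by [].
have := esumID A0 GH a (fun C _ => a0 C).
rewrite setIidr// -/(esum _ _) => E.
move: lt fin; rewrite -/(esum GH a) E esum_fset//.
rewrite -(esum_fset finA0 (fun C _ => a0 C)) -(fineK S_fin).
case: (\esum_(C in GH `&` ~` A0) a C)%E => [t| |]//=.
by rewrite -EFinD lte_fin => lt _; lra.
Qed.

(** The translate of delta_v by [x]: it lives on the coset xH with value [v] at [x], and
    equivariance then forces the factor [sigma (y^-1 * x)]. *)
Definition l2_delta x (v : V) : L2 :=
  insubd 0 (fun y => if (y^-1 * x)%g \in H then sigma (y^-1 * x)%g v else 0).

Lemma l2_deltaE x v y :
  l2_delta x v y = if (y^-1 * x)%g \in H then sigma (y^-1 * x)%g v else 0.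
Proof.
rewrite /l2_delta insubdK//; apply/asboolP; split=> [z h Hh|].
  rewrite invgM -mulgA mem_grpMl//; last exact: grpV.
  case: ifPn => [/set_mem Hz|]; last by rewrite linear0.
  by rewrite sigmaM//; exact: grpV.
rewrite (esum_eq1 (c := lcoset x H)) ?ltry//.
- exact: lcosets_lcoset.
- by rewrite lee_fin normsq_ge0.
- move=> C CH; case: ifPn => [/set_mem Hz|_ _]; last by rewrite /normsq linear0l.
  by rewrite -{1}(lcoset_repr Hgrp CH) -(lcosetMr Hgrp _ Hz) mulgA mulgV mul1g eqxx.
Qed.

Lemma lambda_delta x y v : lam x (l2_delta y v) = l2_delta (x * y)%g v.
Proof.
by apply: l2_ext => z; rewrite lambdaEv !l2_deltaE invgM invgK mulgA.
Qed.

Lemma l2_deltaMr x h v : H h -> l2_delta (x * h)%g v = l2_delta x (sigma h v).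
Proof.
move=> Hh; apply: l2_ext => y; rewrite !l2_deltaE mulgA mem_grpMr//.
by case: ifPn => // /set_mem Hz; rewrite sigmaM.
Qed.

Lemma l2_delta_linear x : linear (l2_delta x).
Proof.
move=> a v w; apply: l2_ext => y.
rewrite l2_addE l2_scaleE !l2_deltaE; case: ifP => _; first by rewrite linearP.
by rewrite scaler0 addr0.
Qed.

(** An equivariant function is determined on a coset by its value at the representative; hence delta
    vectors span the finitely supported elements. *)
Lemma l2_delta_repr xi C y : GH C ->
  l2_delta (Defs.repr C) (xi (Defs.repr C)) y =
  if lcoset y H == C then xi y else 0.
Proof.
move=> CH; rewrite l2_deltaE; case: ifPn => [/set_mem Hz|nHz].
  have yC : lcoset y H = C.
    by rewrite -[RHS](lcoset_repr Hgrp CH) -(lcosetMr Hgrp y Hz) mulgA mulgV mul1g.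
  rewrite yC eqxx -{2}[Defs.repr C](mulVKg y) l2_equivariant//.
  by rewrite -sigmaM//; [rewrite mulgV sigma1|exact: grpV].
case: eqP => // yC; move: nHz; rewrite -yC.
have [h Hh ->] := repr_lcoset Hgrp y.
by rewrite mulgA mulVg mul1g mem_set.
Qed.

Lemma l2_restr_sum A xi : finite_set A -> A `<=` GH ->
  l2_restr A xi =
  \sum_(C <- fset_set A) l2_delta (Defs.repr C) (xi (Defs.repr C)).
Proof.
move=> finA subA; apply: l2_ext => y; rewrite l2_sumE l2_restrE.
rewrite (eq_big_seq (fun C => if lcoset y H == C then xi y else 0)); last first.
  by move=> C; rewrite in_fset_set// => /set_mem/subA; exact: l2_delta_repr.
case: ifPn => yA.
  rewrite (bigD1_seq (lcoset y H)) ?fset_uniq ?in_fset_set//= eqxx.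
  by rewrite big1 ?addr0// => C; rewrite eq_sym => /negbTE ->.
rewrite big1_seq// => C /=; rewrite in_fset_set// => CA.
by case: eqP => // yC; move: yA; rewrite yC CA.
Qed.

Local Notation lamG := [set lam x | x in [set: G]].

Lemma commutant_lambdaP T : commutant lamG T <->
  bounded_op T /\ forall x xi, T (lam x xi) = lam x (T xi).
Proof.
split=> -[bT cT]; split=> //.
  move=> x xi; have := cT (lam x) (ex_intro2 _ _ x Logic.I erefl).
  by move/(congr1 (fun f => f xi)).
by move=> _ [x _ <-]; apply/funext => xi; exact: cT.
Qed.

(** * Hecke algebra elements from operators commuting with lambda *)

Section Symbol.
Variable T : L2 -> L2.
Hypothesis linT : linear T.
Hypothesis comT : forall x xi, T (lam x xi) = lam x (T xi).
Variable A : set (set G).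
Hypothesis finA : finite_set A.
Hypothesis subA : A `<=` GH.
Hypothesis stableA : forall h y, H h -> A (lcoset y H) -> A (lcoset (h * y)%g H).

(* The factor cancels the [Delta^(1/2)] in the definition of [Rtilde]. *)
Definition hecke_symbol (z : G) : 'End(V) :=
  if lcoset z H \in A then
    ((Num.sqrt (modular R (rep_ker H sigma) z))^-1)%:C%C *:
      linfun (fun v => T (l2_delta 1%g v) z^-1%g)
  else 0.

Lemma T_delta x v y : T (l2_delta x v) y = T (l2_delta 1%g v) (x^-1 * y)%g.
Proof. by rewrite -lambdaEv -comT lambda_delta mulg1. Qed.

Lemma hecke_symbolE z v : hecke_symbol z v =
  if lcoset z H \in A then
    ((Num.sqrt (modular R (rep_ker H sigma) z))^-1)%:C%C *:
      T (l2_delta 1%g v) z^-1%g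
  else 0.
Proof.
rewrite /hecke_symbol; case: ifP => _; last by rewrite lfunE.
rewrite lfunE /= linfunE// => a u w.
by rewrite l2_delta_linear linT.
Qed.

Lemma stable_lcoset h y : H h ->
  (lcoset (h * y)%g H \in A) = (lcoset y H \in A).
Proof.
move=> Hh; apply/idP/idP => /set_mem yA; apply/mem_set; last exact: stableA.
by rewrite -(mulKg h y); apply: stableA => //; exact: grpV.
Qed.

(** Right covariance comes from moving [k] into the delta vector, left covariance from the
    equivariance of the values of [T]. The cut-off and the modular factor are constant on double
    cosets. *)
Lemma hecke_symbol_hecke : hecke_algebra H sigma hecke_symbol.
Proof.
split=> [h x k Hh Hk|].
  apply/lfunP => v; rewrite !comp_lfunE !hecke_symbolE.
  rewrite lcosetMr// stable_lcoset//; case: ifP => _; last by rewrite linear0.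
  rewrite (modularMr Hgrp sigmaU)// (modularMl Hgrp sigmaU)// linearZ /=.
  congr (_ *: _); rewrite -l2_deltaMr// mul1g (T_delta k) !invgM mulgA -{2}(invgK h).
  by rewrite -l2_equivariant//; exact: grpV.
apply: sub_finite_set (finite_image (dcoset H) (finite_image (@Defs.repr G) finA)).
move=> _ [x /= Fx <-]; have xA : A (lcoset x H).
  by apply: contrapT => nA; move: Fx; rewrite /hecke_symbol memNset// eqxx.
exists (Defs.repr (lcoset x H)); first by exists (lcoset x H).
have [h Hh ->] := repr_lcoset Hgrp x; apply/seteqP; split=> _ [l Hl [k Hk <-]].
  by exists l => //; exists (h * k)%g; [exact: grpM|rewrite !mulgA].
exists l => //; exists (h^-1 * k)%g; first by apply: grpM => //; exact: grpV.
by rewrite !mulgA mulgK.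
Qed.

Hypothesis hK : hecke_pair (rep_ker H sigma).

(** The modular factors cancel, so the term at [C] is [T] of a delta vector at [repr C], evaluated
    at 1. These delta vectors add up to the cut-off of the translate of [xi]. *)
Lemma Rtilde_symbolE xi y :
  Rtilde dot H sigma hecke_symbol xi y = T (l2_restr A (lam y^-1%g xi)) 1%g.
Proof.
rewrite (RtildeE xi ht hecke_symbol_hecke) /Rtilde_fun.
rewrite -(@fsbig_widen _ _ _ _ A)//; last first.
  move=> C [CH CA]; rewrite /preimage /= hecke_symbolE (lcoset_repr Hgrp CH).
  by rewrite memNset// scaler0.
rewrite fsbig_finite//= l2_restr_sum// linear_l2_sum// l2_sumE.
apply: eq_big_seq => C; rewrite in_fset_set// => CA.
have CH := subA (set_mem CA).
rewrite hecke_symbolE (lcoset_repr Hgrp CH) CA scalerA -rmorphM /= mulfV; last first.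
  by rewrite gt_eqF// sqrtr_gt0 modular_gt0.
by rewrite rmorph1 scale1r (T_delta (Defs.repr C)) mulg1 lambdaEv invgK.
Qed.

(** A delta vector lives on a single coset, so a cut-off keeps it or kills it. The test falls on the
    coset of [y^-1 * x] and becomes a cut-off in [y]. *)
Lemma Rtilde_symbol_delta x v : Rtilde dot H sigma hecke_symbol (l2_delta x v) =
  l2_restr [set C | A (lcoset ((Defs.repr C)^-1 * x)%g H)] (T (l2_delta x v)).
Proof.
apply: l2_ext => y; rewrite Rtilde_symbolE lambda_delta l2_restrE.
have [h Hh rE] := repr_lcoset Hgrp y.
(* Passing from [y] to its representative multiplies [y^-1 * x] on the left by an element of [H],
   which the stability of [A] absorbs. *)
have -> : (lcoset y H \in [set C | A (lcoset ((Defs.repr C)^-1 * x)%g H)]) =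
    (lcoset (y^-1 * x)%g H \in A).
  rewrite -[RHS](stable_lcoset (h := h^-1%g)); last exact: grpV.
  by rewrite mulgA -invgM -rE; apply/idP/idP => /set_mem ?; apply/mem_set.
have -> : l2_restr A (l2_delta (y^-1 * x)%g v) =
    if lcoset (y^-1 * x)%g H \in A then l2_delta (y^-1 * x)%g v else 0.
  set w := (y^-1 * x)%g; apply: l2_ext => z; rewrite l2_restrE [in LHS]l2_deltaE.
  case: (boolP (_ \in H)) => [Hz|nHz]; last first.
    by rewrite if_same; case: ifP => // _; rewrite l2_deltaE (negbTE nHz).
  have <- : lcoset z H = lcoset w H.
    by rewrite -[w](mulVKg z) lcosetMr//; exact: set_mem.
  by case: ifP => // _; rewrite l2_deltaE Hz.
case: ifP => _; last by rewrite linear_l2_0.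
by rewrite (T_delta (y^-1 * x)%g) (T_delta x) mulg1 invgM invgK.
Qed.

End Symbol.

(** * The commutant of lambda(G) commutes with that of the Hecke operators *)

(** The coset hxH depends only on [h] modulo the intersection of [H] with its conjugate by [x],
    which has finite index in [H]; so HA is finite. *)
Lemma left_stable_cover A : finite_set A -> A `<=` GH ->
  exists B, [/\ finite_set B, B `<=` GH, A `<=` B &
    forall h y, H h -> B (lcoset y H) -> B (lcoset (h * y)%g H)].
Proof.
move=> finA subA.
pose g C (D : set G) := lcoset (Defs.repr D * Defs.repr C)%g H.
exists [set lcoset (h * Defs.repr C)%g H | h in H & C in A]; split.
- apply: sub_finite_set (bigcup_finite (F := fun C =>
    g C @` lcosets H (H `&` conjugate (Defs.repr C) H)) finA _); last first.
    by move=> C _; apply: finite_image; exact: Hfin.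
  move=> _ [h Hh [C CA <-]]; exists C => //; set x := Defs.repr C.
  exists (lcoset h (H `&` conjugate x H)); first by exists h.
  have [l [Hl [l' Hl' l'E]] lE] : lcoset h (H `&` conjugate x H)
      (Defs.repr (lcoset h (H `&` conjugate x H))).
    apply: xgetPex; exists (h * 1)%g; exists 1%g => //; split; first exact: grp1.
    by exists 1%g; [exact: grp1|rewrite mulg1 mulgV].
  rewrite /g -lE -l'E -[RHS](lcosetMr Hgrp _ Hl'); congr (lcoset _ H).
  by rewrite -/x !mulgA mulgVK.
- by move=> _ [h _ [C _ <-]]; exact: lcosets_lcoset.
- move=> C CA; exists 1%g; first exact: grp1.
  by exists C => //; rewrite mul1g (lcoset_repr Hgrp (subA _ CA)).
- move=> h y Hh [k Hk [C CA e]]; exists (h * k)%g; first exact: grpM.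
  exists C => //; have [l Hl ->] := lcoset_eq Hgrp e.
  by rewrite mulgA (lcosetMr Hgrp _ Hl) mulgA.
Qed.

Lemma le_epsilonM (a c : R) : 0 <= c -> (forall e, 0 < e -> a <= c * e) -> a <= 0.
Proof.
move=> c0 le; rewrite leNgt; apply/negP => a0.
(* The shift by 1 covers [c = 0]; the choice [e = a / (c + 1)] gives [a * (c + 1) <= c * a]. *)
have c1 : 0 < c + 1 by lra.
have := le (a / (c + 1)) (divr_gt0 a0 c1).
by rewrite mulrA ler_pdivlMr// => ?; nra.
Qed.

(** At a fixed point [y], a single symbol [F] makes its operator close to [T] both at [S xi],
    evaluated at [y], and at [xi], in norm. Since this operator commutes with [S], the difference at
    [y] is arbitrarily small. *)
Lemma commute_delta T S : hecke_pair (rep_ker H sigma) ->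
  commutant lamG T -> commutant (Rtilde dot H sigma @` hecke_algebra H sigma) S ->
  forall x v, T (S (l2_delta x v)) = S (T (l2_delta x v)).
Proof.
move=> hK /commutant_lambdaP[/bounded_opP[linT [M M0 MP]] comT].
move=> [/bounded_opP[linS [N N0 NP]] comS] x v.
set xi := l2_delta x v; apply: l2_ext => y; apply/eqP; rewrite -subr_eq0.
apply/eqP/(normsq_eq0 (dot := dot))/eqP; rewrite eq_le normsq_ge0 andbT.
apply: (@le_epsilonM _ (2 * (M + N))) => [|e e0]; first by rewrite mulr_ge0// addr_ge0.
have [A1 [finA1 subA1 tail1]] := l2_restr_tail (T xi) e0.
have [A2 [finA2 subA2 tail2]] := l2_restr_tail (lam y^-1%g (S xi)) e0.
(* These cosets must lie in the support of the cut-off for the set in [Rtilde_symbol_delta] to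
   contain [A1]. *)
pose A1' := (fun C => lcoset ((Defs.repr C)^-1 * x)%g H) @` A1.
have [||A [finA subA cover stableA]] := @left_stable_cover (A2 `|` A1').
- by rewrite finite_setU; split=> //; exact: finite_image.
- by move=> C [/subA2//|[D _ <-]]; exact: lcosets_lcoset.
set F := hecke_symbol T A.
have HF : hecke_algebra H sigma F by exact: hecke_symbol_hecke.
have RS : Rtilde dot H sigma F (S xi) = S (Rtilde dot H sigma F xi).
  have := comS _ (ex_intro2 _ _ F HF erefl).
  by move/(congr1 (fun f => f xi)).
have -> : T (S xi) y - S (T xi) y =
    (T (S xi) y - Rtilde dot H sigma F (S xi) y) -
    (S (T xi - Rtilde dot H sigma F xi) y).
  by rewrite linear_l2B// l2_addE l2_oppE -RS opprB addrC addrA subrK addrC.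
(* The factor 2 is spent here; [M] and [N] bound the two differences. *)
apply: le_trans (normsqB _ _ _) _; rewrite -mulrA ler_pM2l// mulrDl lerD//.
  rewrite Rtilde_symbolE//.
  have -> : T (S xi) y = T (lam y^-1%g (S xi)) 1%g.
    by rewrite comT lambdaEv invgK mulg1.
  rewrite -l2_oppE -l2_addE -linear_l2B//.
  apply: le_trans (normsq_le_l2_sq _ _) _; apply: le_trans (MP _) _.
  by rewrite ler_wpM2l// tail2// => C AC; apply: cover; left.
apply: le_trans (normsq_le_l2_sq _ _) _; apply: le_trans (NP _) _.
rewrite ler_wpM2l// Rtilde_symbol_delta// tail1// => C AC.
by apply: cover; right; exists C.
Qed.

(** The commutator is bounded and vanishes on delta vectors, hence on all finite cut-offs, and these
    approximate every [xi]. *)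
Lemma commutation T S : hecke_pair (rep_ker H sigma) ->
  commutant lamG T -> commutant (Rtilde dot H sigma @` hecke_algebra H sigma) S ->
  T \o S = S \o T.
Proof.
move=> hK cT cS; have deltaTS := commute_delta hK cT cS.
move: cT cS => [bT _] [bS _].
have /bounded_opP[] := bounded_op_sub (bounded_op_comp bT bS) (bounded_op_comp bS bT).
set D := fun xi => _; move=> linD [M M0 MP].
have DE xi : D xi = T (S xi) - S (T xi) by [].
apply/funext => xi /=; apply/eqP; rewrite -subr_eq0 -DE; apply/eqP.
apply: l2_ext => y; apply/(normsq_eq0 (dot := dot))/eqP.
rewrite eq_le normsq_ge0 andbT; apply: (le_epsilonM M0) => e e0.
have [A [finA subA tailA]] := l2_restr_tail xi e0.
apply: le_trans (normsq_le_l2_sq _ _) _.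
have <- : D (xi - l2_restr A xi) = D xi.
  rewrite linear_l2B// l2_restr_sum// linear_l2_sum// big1 ?subr0// => C _.
  by rewrite DE deltaTS subrr.
by apply: le_trans (MP _) _; rewrite ler_wpM2l// tailA.
Qed.

(** * The Hecke operators commute with lambda(G) *)

Lemma Rtilde_linear f : hecke_algebra H sigma f -> linear (Rtilde dot H sigma f).
Proof.
move=> Hf a xi eta; apply: l2_ext => y.
rewrite l2_addE l2_scaleE !(RtildeE _ ht Hf) !(Rtilde_fun_supp Hgrp Hfin Hf).
rewrite scaler_sumr -big_split /=; apply: eq_bigr => C _.
by rewrite !fctE linearP scalerDr !scalerA mulrC.
Qed.

(** [Rtilde] combines right translations, which commute with the left translations [lam x]. *)
Lemma Rtilde_commutant f :
  hecke_algebra H sigma f -> commutant lamG (Rtilde dot H sigma f).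
Proof.
move=> Hf; apply/commutant_lambdaP; split; last first.
  move=> x xi; apply: l2_ext => y; rewrite lambdaEv !(RtildeE _ ht Hf).
  by apply: eq_fsbigr => C _; rewrite lambdaEv mulgA.
apply/bounded_opP; split; first exact: Rtilde_linear.
have [M M0 MP] := Rtilde_fun_bound Hgrp sigmaU Hfin Hf.
exists M => // xi; rewrite -lee_fin EFinM !l2_sqE (RtildeE _ ht Hf).
by apply: MP => *; exact: l2_equivariant.
Qed.

(** * The inner product of l^2; the commutant of lambda(G) is a von Neumann algebra *)

Lemma csum_reindex (I J : choiceType) (P : set I) (Q : set J) (e : I -> J)
    (a : J -> R[i]) : set_bij P Q e -> csum Q a = csum P (fun i => a (e i)).
Proof. by move=> bij; rewrite /csum /rsum !(reindex_esum _ _ _ _ bij). Qed.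

Lemma csum_eq1 (I : choiceType) (D : set I) (a : I -> R[i]) c :
  D c -> (forall i, D i -> i != c -> a i = 0) -> csum D a = a c.
Proof.
move=> Dc a0.
have rsum_eq1 (b : I -> R) : (forall i, D i -> i != c -> b i = 0) -> rsum D b = b c.
  move=> b0; rewrite /rsum !(esum_eq1 (c := c))//=; last 4 first.
  - by rewrite lee_fin le_max lexx orbT.
  - by move=> i Di ic; rewrite b0// oppr0 maxxx.
  - by rewrite lee_fin le_max lexx orbT.
  - by move=> i Di ic; rewrite b0// maxxx.
  rewrite /Num.max oppr_lt0; case: ltgtP => [_|_|->].
  - by rewrite sub0r opprK.
  - by rewrite subr0.
  - by rewrite oppr0 subr0.
rewrite /csum !rsum_eq1; last 2 first.
- by move=> i Di ic; rewrite a0.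
- by move=> i Di ic; rewrite a0.
by case: (a c).
Qed.

Lemma dot_sigma h u v : H h -> dot (sigma h u) (sigma h v) = dot u v.
Proof. by case: sigmaU => _ _ iso Hh; exact: iso. Qed.

(** Translate the cosets by [x]. Passing to the chosen representatives puts the same [sigma h^-1] on
    both arguments, where unitarity removes it. *)
Lemma l2_dot_lambda x xi eta : l2_dot (lam x^-1%g xi) eta = l2_dot xi (lam x eta).
Proof.
rewrite /l2_dot [RHS](csum_reindex _ (lcoset_translate_bij Hgrp x)).
congr csum; apply/funext => C; rewrite !lambdaEv invgK.
have [h Hh ->] := repr_lcoset Hgrp (x * Defs.repr C)%g.
rewrite [(x^-1 * _)%g]mulgA mulKg !(l2_equivariant _ _ Hh) dot_sigma//.
exact: grpV.
Qed.

(** Only the coset of [x] contributes. Pairing with delta vectors thus detects the values of an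
    element of l^2. *)
Lemma l2_dot_delta x v xi : l2_dot (l2_delta x v) xi = dot v (xi x).
Proof.
rewrite /l2_dot (csum_eq1 (c := lcoset x H)); last 2 first.
- exact: lcosets_lcoset.
- move=> C CH; rewrite l2_deltaE; case: ifPn => [/set_mem Hz|_ _]; last first.
    by rewrite linear0l.
  by rewrite -{1}(lcoset_repr Hgrp CH) -(lcosetMr Hgrp _ Hz) mulVKg eqxx.
have [h Hh ->] := repr_lcoset Hgrp x.
have HhV := grpV Hgrp Hh.
by rewrite l2_deltaE invgM mulgVK mem_set// l2_equivariant// dot_sigma.
Qed.

Lemma l2_dot_inj xi eta :
  (forall zeta : L2, l2_dot zeta xi = l2_dot zeta eta) -> xi = eta.
Proof.
move=> e; apply: l2_ext => y; apply/eqP; rewrite -subr_eq0 -(dnorm_eq0 dot).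
have de d : dot d (xi y) = dot d (eta y) by rewrite -!l2_dot_delta e.
by rewrite linearBr /= de subrr.
Qed.

(** The adjoint of [lam x] is again in lambda(G), so the relation can be tested weakly by moving [S]
    and [lam x] across the inner product. *)
Lemma commutant_lambda_adjoint S T :
  commutant lamG S -> bounded_op T -> adjoint S T -> commutant lamG T.
Proof.
move=> /commutant_lambdaP[_ comS] bT adj; apply/commutant_lambdaP; split=> // x xi.
by apply: l2_dot_inj => zeta; rewrite -adj -l2_dot_lambda -comS adj l2_dot_lambda.
Qed.

Lemma commutant_lambda_von_neumann : von_neumann_algebra (commutant lamG).
Proof.
split; first split.
- by move=> T [].
- apply/commutant_lambdaP; split; last first.
    by move=> x xi; apply: l2_ext => y; rewrite lambdaEv.
  apply/bounded_opP; split; first by move=> a xi eta; rewrite scaler0 addr0.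
  by exists 0 => // xi; rewrite mul0r l2_sq0.
- move=> a S T /commutant_lambdaP[bS cS] /commutant_lambdaP[bT cT].
  apply/commutant_lambdaP; split; first exact: bounded_op_lin.
  by move=> x xi; rewrite !fctE cS cT lambda_linear.
- move=> S T /commutant_lambdaP[bS cS] /commutant_lambdaP[bT cT].
  apply/commutant_lambdaP; split; first exact: bounded_op_comp.
  by move=> x xi /=; rewrite cT cS.
- by move=> S T; exact: commutant_lambda_adjoint.
(* The triple commutant is the commutant: each [lam x] is bounded and lies in the bicommutant of
   lambda(G). *)
apply/seteqP; split=> T [bT cT]; split=> //.
  move=> _ [x _ <-]; apply: cT; split; first exact: lambda_bounded.
  by move=> S [_ cS]; rewrite cS//; exists x.
by move=> S [_ cS]; rewrite cS.
Qed.

End InducedRepresentation.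

Theorem theorem4p5 (R : realType) (G : groupType) (n : nat) (V : vectType R[i])
    (dot : {dot V for Num.Def.conjC}) (H : set G) (sigma : G -> 'End(V)) :
  reduced_hecke_triple dot H sigma n ->
  commutant [set lambda dot H sigma x | x in setT] =
  von_neumann_generated (Rtilde dot H sigma @` hecke_algebra H sigma).
Proof.
move=> [ht [hK _]]; apply/seteqP; split=> T cT.
  (* As [M] is its own bicommutant, it suffices that [T] commutes with every [S] in the commutant of
     [M]; such an [S] commutes with the Hecke operators. *)
  move=> M [[[Mb _ _ _ _] MM] subM]; rewrite -MM; split; first by case: cT.
  move=> S [bS cS]; apply: (commutation ht hK cT).
  by split=> // _ [f Hf <-]; apply: cS; apply: subM; exists f.
(* The commutant of lambda(G) is one of the algebras being intersected. *)
apply: cT; split; first exact: (commutant_lambda_von_neumann ht).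
by move=> _ [f Hf <-]; exact: (Rtilde_commutant ht Hf).
Qed.
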